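(* For all integers $0\le j\le n$ and all real $x,y$, $$B_j^n(xy)=\sum_{k=j}^{n}B_j^k(x)\,B_k^n(y),$$ where $B_k^n$ denotes the Bernstein basis function.
   Context: The Bernstein basis functions are $B_k^n(x)=\binom{n}{k}x^k(1-x)^{n-k}$ for integers $0\le k\le n$ (with $0^0=1$). *)

(* Defs.v *)
From mathcomp Require Import all_boot all_order all_algebra.
From mathcomp Require Import reals.

Set Implicit Arguments.
Unset Strict Implicit.
Unset Printing Implicit Defensive.

Import GRing.Theory.

Local Open Scope ring_scope.

(* The degree comes first: [bernstein n k x] is $B_k^n(x)$. The convention
   $0^0 = 1$ holds since [x ^+ 0] is [1]. For [k > n], outside the usual index
   range, the value is 0 because ['C(n, k)] is. *)
Definition bernstein (R : realType) (n k : nat) (x : R) : R :=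
  'C(n, k)%:R * x ^+ k * (1 - x) ^+ (n - k).

(* Main.v *)
(** Since [1 - x * y = (1 - y) + y * (1 - x)], expanding the factor
    [(1 - x * y) ^+ (n - j)] of the left-hand side by the binomial theorem
    gives the right-hand side term by term, up to trinomial revision. *)
Require Import Defs.
From mathcomp Require Import all_boot all_order all_algebra.
From mathcomp Require Import reals.
From mathcomp Require Import ring.

Import GRing.Theory.

Local Open Scope ring_scope.

(** Multiplying either side by the positive number $j!\,(k-j)!\,(n-k)!$ gives $n!$. *)
Lemma bin_trinomial (n k j : nat) : (j <= k)%N -> (k <= n)%N ->
  ('C(n, k) * 'C(k, j) = 'C(n, j) * 'C(n - j, k - j))%N.
Proof.
move=> jk kn; have jn := leq_trans jk kn.
have f_gt0 : (0 < j`! * (k - j)`! * (n - k)`!)%N by rewrite !muln_gt0 !fact_gt0.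
apply/eqP; rewrite -(eqn_pmul2r f_gt0); apply/eqP.
transitivity (n`!).
  by rewrite -(bin_fact kn) -(bin_fact jk); ring.
have := bin_fact (leq_sub2r j kn); rewrite subnBA // subnK // => nj_fact.
by rewrite -(bin_fact jn) -nj_fact; ring.
Qed.

Theorem theorem4 (R : realType) (j n : nat) (hjn : (j <= n)%N) (x y : R) :
  bernstein n j (x * y) =
    \sum_(j <= k < n.+1) bernstein k j x * bernstein n k y.
Proof.
(* Shifting to [k = i + j] makes [i] run from 0 to [n - j], the range of the binomial expansion of
   exponent [n - j]. *)
rewrite -[X in index_iota X]add0n big_addn subSn // big_mkord /bernstein.
have -> : 1 - x * y = (1 - y) + y * (1 - x) by ring.
rewrite exprDn mulr_sumr; apply: eq_bigr => i _.
have le_ij : (i + j <= n)%N by rewrite addnC -leq_subRL // -ltnS.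
have := bin_trinomial n (i + j) j (leq_addl i j) le_ij.
rewrite addnK => /(congr1 (fun m => m%:R : R)); rewrite !natrM => bin_eq.
(* Both exponents of [1 - y] become [n - j - i], since [ring] does not see through truncated
   subtraction; [bin_eq] then matches the coefficients. *)
rewrite -mulr_natr addnC subnDA !exprMn exprD [(j + i)%N]addnC.
ring: bin_eq.
Qed.
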